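(* Let $D\subset\mathbb{C}^N$ be a domain with $D=\operatorname{int}(\overline{D})$, and let $\mu$ be a weight on the closure $\overline{D}$ of $D$ in $\mathbb{C}^N$ such that the measure of the boundary $\partial D$ given by $\mu$ is zero, i.e. $\int_{\partial D}\mu\,dV=0$, and $\mu_{|D}\in AW(D)$. Suppose that for some sequence of domains $\{D_n\}$ approximating $D$ from outside, and some sequence of admissible weights $\mu_n\in AW(D_n)$: (1) the restrictions of $K_{D_n,\mu_n}$ to $D\times D$ converge to $K_{D,\mu}$ locally uniformly on $D\times D$ as $n\to\infty$; (2) for every $t\in D$ and every $n$, $K_{D_n,\mu_n}(\cdot,t)_{|D}\in L^2_H(D,\mu)$, and $$\lim_{n\to\infty}\|K_{D_n,\mu_n}(\cdot,t)\|_\mu^2=\|K_{D,\mu}(\cdot,t)\|_\mu^2=K_{D,\mu}(t,t),$$ where $\|\cdot\|_\mu$ is the norm of $L^2(D,\mu)$ (integration over $D$). Then $H(\overline{D},\mu)$ is dense in $L^2(\overline{D},\mu)$.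
   Context: A sequence of domains $\{D_n\}$ approximates $D$ from outside if $D\subset D_n$ for all $n$, and for each open $G$ with $\overline{D}\subset G$ one has $D\subset D_m\Subset G$ for all sufficiently large $m$ (where $D_m\Subset G$ means that $\overline{D_m}$ is a compact subset of $G$). A weight on a measurable set is a Lebesgue measurable, real-valued, positive function on it (two weights are identified if equal almost everywhere). For a weight $\mu$ on an open set $\Omega$, the usual weighted space $L^2(\Omega,\mu)$ of Lebesgue measurable complex-valued functions has norm $\|f\|_\mu^2=\int_\Omega|f|^2\mu\,dV$ ($dV$ is Lebesgue measure) and scalar product $\langle f|g\rangle_\mu=\int_\Omega f\overline{g}\,\mu\,dV$; $L^2_H(\Omega,\mu)$ is its subspace of functions holomorphic on $\Omega$. A weight $\mu$ is admissible, written $\mu\in AW(\Omega)$, if $L^2_H(\Omega,\mu)$ is a closed subspace of $L^2(\Omega,\mu)$ and for every $z\in \Omega$ the evaluation functional $f\mapsto f(z)$ is continuous on $L^2_H(\Omega,\mu)$. For the closed set $\overline{D}$, $L^2(\overline{D},\mu)$ denotes the space of all complex-valued functions which are square integrable on $\overline{D}$ with respect to $\mu\,dV$ and holomorphic in the interior of $\overline{D}$; $H(\overline{D},\mu)$ is the subset of $L^2(\overline{D},\mu)$ consisting of functions possessing a holomorphic extension to an open neighborhood of $\overline{D}$. For an admissible weight $\mu$ on a domain $\Omega$ and $t\in \Omega$, if the class $\{f\in L^2_H(\Omega,\mu): f(t)=1\}$ is nonempty, it has a unique element $\phi_\mu(\cdot,t)$ of minimal norm, and the weighted Bergman kernel is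 $K_{\Omega,\mu}(z,t)=\phi_\mu(z,t)/\|\phi_\mu(\cdot,t)\|_\mu^2$; if the class is empty, $K_{\Omega,\mu}(\cdot,t)\equiv 0$. Equivalently, $K_{\Omega,\mu}$ is the reproducing kernel of $L^2_H(\Omega,\mu)$: $K_{\Omega,\mu}(\cdot,t)\in L^2_H(\Omega,\mu)$ and $f(t)=\langle f|K_{\Omega,\mu}(\cdot,t)\rangle_\mu$ for all $f\in L^2_H(\Omega,\mu)$. For $\mu$ a weight on $\overline D$ with $\mu_{|D}\in AW(D)$, $K_{D,\mu}$ and $L^2_H(D,\mu)$ mean $K_{D,\mu_{|D}}$ and $L^2_H(D,\mu_{|D})$.
   Formalization: ''Approximates from outside'' is taken to require closure(D) ⊂ D_m ⋐ G for all large m, instead of only D ⊂ D_m ⋐ G; with the latter the claim fails for D_n = D the Hartogs triangle with weights 1. *)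

(* Defs.v *)
(* MathComp / MathComp-Analysis; C^N is 'rV[R[i]]_N.+1 over a realType R. *)
From HB Require Import structures.
From mathcomp Require Import all_boot all_order all_algebra.
From mathcomp Require Import complex.
From mathcomp Require Import all_classical all_reals all_analysis.

Set Implicit Arguments.
Unset Strict Implicit.
Unset Printing Implicit Defensive.

Import Order.TTheory GRing.Theory Num.Theory.
Import numFieldNormedType.Exports.

Local Open Scope classical_set_scope.
Local Open Scope ring_scope.

(* The usual topology and norm of the complex numbers, as a field over itself;
   [differentiable] on R[i]-normed modules is then complex differentiability. *)
HB.instance Definition _ (R : rcfType) := PseudoPointedMetric.copy R[i] R[i]^o.
HB.instance Definition _ (R : rcfType) := NormedModule.copy R[i] R[i]^o.

Notation Cvec R n := 'rV[R[i]]_n.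

Section lebesgue_outer_measure.
Context (R : realType) (N : nat).
Implicit Types (a b z : Cvec R N.+1) (A : set (Cvec R N.+1)).

Definition cbox a b : set (Cvec R N.+1) :=
  [set z | forall j,
    (complex.Re (a 0 j) <= complex.Re (z 0 j) < complex.Re (b 0 j)) &&
    (complex.Im (a 0 j) <= complex.Im (z 0 j) < complex.Im (b 0 j))].

(* Vanishes when some side is degenerate, i.e. when [cbox a b] is empty. *)
Definition cbox_vol a b : R :=
  \prod_j (Num.max 0 (complex.Re (b 0 j) - complex.Re (a 0 j)) *
           Num.max 0 (complex.Im (b 0 j) - complex.Im (a 0 j))).

Definition cbox_cover A : set (nat -> Cvec R N.+1 * Cvec R N.+1) :=
  [set F | A `<=` \bigcup_k cbox (F k).1 (F k).2].

Definition lebesgue_outer A : \bar R :=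
  ereal_inf [set (\sum_(k <oo) (cbox_vol (F k).1 (F k).2)%:E)%E
            | F in cbox_cover A].

Lemma cbox_vol_ge0 a b : 0 <= cbox_vol a b.
Proof. by apply: prodr_ge0 => j _; rewrite mulr_ge0// le_max lexx. Qed.

Let vE (p : Cvec R N.+1 * Cvec R N.+1) : \bar R := (cbox_vol p.1 p.2)%:E.

Let vE_ge0 p : (0 <= vE p)%E.
Proof. by rewrite lee_fin cbox_vol_ge0. Qed.

Lemma lebesgue_outer_ge0 A : (0 <= lebesgue_outer A)%E.
Proof.
apply: le_ereal_inf_tmp => _ [F AF <-].
by apply: nneseries_ge0 => k _ _; exact: (vE_ge0 (F k)).
Qed.

Lemma lebesgue_outer0 : lebesgue_outer set0 = 0%E.
Proof.
apply/eqP; rewrite eq_le lebesgue_outer_ge0 andbT.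
apply: ereal_inf_lbound; exists (fun=> (0, 0)); first by move=> ? [].
rewrite eseries0// => k _ _ /=; congr (_%:E).
by rewrite /cbox_vol big_ord_recl subrr /Num.max ltxx !mul0r.
Qed.

Lemma lebesgue_outer_subset_sigma_subadditive A (F : nat -> set (Cvec R N.+1)) :
  subset_sigma_subadditive lebesgue_outer A F.
Proof.
move=> AF.
have [[i ioo]|] := pselect (exists i, lebesgue_outer (F i) = +oo%E).
  rewrite (eseries_pinfty _ _ ioo) ?leey// => n _.
  by rewrite -ltNye (lt_le_trans _ (lebesgue_outer_ge0 _)).
rewrite -forallNE => Foo.
suff add2e (e : {posnum R}) :
    (lebesgue_outer A <= \sum_(i <oo) lebesgue_outer (F i) + e%:num%:E)%E.
  by apply/lee_addgt0Pr => _/posnumP[].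
rewrite (le_trans _ (epsilon_trick _ _ _))//; last first.
  by move=> n; exact: lebesgue_outer_ge0.
pose P n (B : nat -> Cvec R N.+1 * Cvec R N.+1) := cbox_cover (F n) B /\
  (\sum_(k <oo) vE (B k) <=
     lebesgue_outer (F n) + (e%:num / (2 ^ n.+1)%:R)%:E)%E.
have [G PG] : {G & forall n, P n (G n)}.
  apply: (@choice _ _ P) => n; rewrite /P.
  have en1 : 0 < e%:num / (2 ^ n.+1)%:R :> R by [].
  have fin : lebesgue_outer (F n) \is a fin_num.
    rewrite ge0_fin_numE ?lebesgue_outer_ge0// ltey.
    by apply/eqP; exact: Foo.
  have [x [B FB <-] xS] := lb_ereal_inf_adherent en1 fin.
  by exists B; split => //; exact/ltW.
have vG_ge0 x : (0 <= (vE \o uncurry G) x)%E by exact: vE_ge0.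
apply: (@le_trans _ _ (\esum_(i in setT) (vE \o uncurry G) i)%E).
  apply: ereal_inf_lbound => /=.
  have /card_esym/ppcard_eqP[f] := card_nat2.
  exists (uncurry G \o f).
    move=> t /AF[i _ /(PG i).1[j _ Bijt]].
    by exists (f^-1%FUN (i, j)) => //=; rewrite invK ?inE.
  rewrite -[LHS]/((\sum_(k <oo) vE ((uncurry G \o f) k))%E).
  rewrite -(esum_pred_image (vE \o uncurry G) _ xpredT) ?[fun=> _]set_true//.
  by rewrite image_eq.
rewrite (_ : esum _ _ = (\sum_(i <oo) \sum_(j <oo ) vE (G i j))%E); last first.
  pose J : nat -> set (nat * nat) := fun i => [set (i, j) | j in setT].
  rewrite (_ : setT = \bigcup_k J k); last first.
    by rewrite predeqE => -[a b]; split => // _; exists a => //; exists b.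
  rewrite esum_bigcupT /=; last 2 first.
    - apply/trivIsetP => i j _ _ ij.
      rewrite predeqE => -[n m] /=; split => //= -[] [_] _ [<-{n} _].
      by move=> [m' _] [] /esym/eqP; rewrite (negbTE ij).
    - by move=> /= [n m]; exact: vG_ge0.
  rewrite -(image_id [set: nat]) -fun_true esum_pred_image//; last first.
    by move=> n _; exact: esum_ge0.
  apply: eq_eseriesr => /= j _.
  rewrite -(esum_pred_image (vE \o uncurry G) (pair j) predT)//=; last first.
    by move=> ? ? _ _; exact: (@can_inj _ _ _ snd).
  by congr esum; rewrite predeqE => -[a b]; split; move=> [i _ <-]; exists i.
apply: lee_lim.
- apply: is_cvg_nneseries => n *.
  by apply: nneseries_ge0 => m *; exact: (vG_ge0 (n, m)).
- by apply: is_cvg_nneseries => n *; apply: adde_ge0 => //; exact: lebesgue_outer_ge0.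
- by near=> n; apply: lee_sum => i _; exact: (PG i).2.
Unshelve. all: by end_near. Qed.

HB.instance Definition _ := isSubsetOuterMeasure.Build R (Cvec R N.+1)
  lebesgue_outer lebesgue_outer0 lebesgue_outer_ge0
  lebesgue_outer_subset_sigma_subadditive.

End lebesgue_outer_measure.

(* C^(N+1) with the sigma-algebra of Lebesgue (= Caratheodory) measurable sets. *)
Notation lebCvec R N := (caratheodory_type (@lebesgue_outer R N)).

Definition dV {R : realType} {N : nat} : set (lebCvec R N) -> \bar R :=
  @lebesgue_outer R N.

HB.instance Definition _ (R : realType) (N : nat) :=
  isMeasure.Build _ _ _ (@dV R N)
    (@caratheodory_measure0 _ _ (@lebesgue_outer R N))
    (@caratheodory_measure_ge0 _ _ (@lebesgue_outer R N))
    (@caratheodory_measure_sigma_additive _ _ (@lebesgue_outer R N)).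

Section weighted_spaces.
Context (R : realType) (N : nat).
Notation CN := (Cvec R N.+1).
Notation normc := ComplexField.Normc.normc.
Implicit Types (A D U Omega : set CN) (mu : CN -> R) (f g h : CN -> R[i]).
Implicit Types (t z : CN).

Definition is_domain D := [/\ D !=set0, open D & connected D].

Definition holomorphic U f := forall z, U z -> differentiable f z.

(* Functions on A are represented by total functions, whose values off A are
   irrelevant. *)
Definition weight A mu :=
  measurable_fun (A : set (lebCvec R N)) (mu : lebCvec R N -> R) /\
  (forall z, A z -> 0 < mu z).

Definition cmeasurable_fun A f :=
  measurable_fun (A : set (lebCvec R N))
    ((fun z => complex.Re (f z)) : lebCvec R N -> R) /\
  measurable_fun (A : set (lebCvec R N))
    ((fun z => complex.Im (f z)) : lebCvec R N -> R).

Definition L2sqr A mu f : \bar R :=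
  (\int[dV]_(z in (A : set (lebCvec R N))) (normc (f z) ^+ 2 * mu z)%:E)%E.

Definition L2 A mu : set (CN -> R[i]) :=
  [set f | cmeasurable_fun A f /\ (L2sqr A mu f < +oo)%E].

(* The norm of L^2(A, mu); meaningful for elements of [L2 A mu] only. *)
Definition L2norm A mu f : R := Num.sqrt (fine (L2sqr A mu f)).

Definition L2H Omega mu : set (CN -> R[i]) :=
  L2 Omega mu `&` holomorphic Omega.

(* L^2_H is closed in L^2, whose elements are classes of a.e. equal functions. *)
Definition L2H_closed Omega mu := forall g, L2 Omega mu g ->
  (forall e : R, 0 < e ->
    exists2 f, L2H Omega mu f & L2norm Omega mu (g \- f) < e) ->
  exists2 h, L2H Omega mu h &
    {ae (@dV R N), forall z, Omega z -> g z = h z}.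

Definition eval_continuous Omega mu t := forall f, L2H Omega mu f ->
  forall e : R, 0 < e -> exists2 d : R, 0 < d &
    forall g, L2H Omega mu g -> L2norm Omega mu (g \- f) < d ->
      normc (g t - f t) < e.

Definition AW Omega : set (CN -> R) :=
  [set mu | [/\ weight Omega mu, L2H_closed Omega mu &
                forall t, Omega t -> eval_continuous Omega mu t]].

Definition normalized_at Omega mu t : set (CN -> R[i]) :=
  [set f | L2H Omega mu f /\ f t = 1].

Definition minimal_at Omega mu t : set (CN -> R[i]) :=
  [set f | normalized_at Omega mu t f /\
    forall g, normalized_at Omega mu t g ->
      L2norm Omega mu f <= L2norm Omega mu g].

(* For admissible mu and t in Omega the minimal function exists, and is unique
   on Omega, as soon as some function is normalized at t. *)
Definition minimal_fun Omega mu t : CN -> R[i] :=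
  xget (fun=> 0) (minimal_at Omega mu t).

Definition bergman_kernel Omega mu z t : R[i] :=
  if `[< normalized_at Omega mu t !=set0 >] then
    minimal_fun Omega mu t z /
      real_complex R (L2norm Omega mu (minimal_fun Omega mu t) ^+ 2)
  else 0.

(* D_m eventually contains the closure of D, and not only D: otherwise the
   constant sequence D_n = D would approximate any bounded D from outside. *)
Definition approximates_from_outside D (Dn : nat -> set CN) :=
  (forall n, D `<=` Dn n) /\
  (forall G, open G -> closure D `<=` G ->
    \forall m \near \oo, [/\ closure D `<=` Dn m,
      compact (closure (Dn m)) & closure (Dn m) `<=` G]).

Definition cvg_locally_uniformly_on (T : topologicalType) (A : set T)
    (Fn : nat -> T -> R[i]) (F : T -> R[i]) :=
  forall p, A p -> exists2 V, nbhs p V & {uniform V `&` A, Fn @ \oo --> F}.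

Definition L2closure D mu : set (CN -> R[i]) :=
  L2 (closure D) mu `&` holomorphic (closure D)°.

Definition Hclosure D mu : set (CN -> R[i]) :=
  L2closure D mu `&` [set f | exists U (g : CN -> R[i]),
    [/\ open U, closure D `<=` U, holomorphic U g &
        forall z, closure D z -> f z = g z]].

End weighted_spaces.

(* Main.v *)
(* The kernels k_n = K_{D_n,mu_n}(., t) belong to H(closure D, mu) for large n, and the
   reproducing property of K = K_{D,mu}(., t) gives
     ||k_n - K||^2 = ||k_n||^2 - 2 Re k_n(t) + ||K||^2 -> K(t,t) - 2 K(t,t) + K(t,t) = 0.
   Let h in L^2_H(D, mu) be the limit of a minimizing sequence for the distance from f to
   H(closure D, mu). Then u = f - h satisfies ||u + c K|| >= ||u|| for all complex c, and
   ||u + c K||^2 = ||u||^2 + 2 Re (conj c * u(t)) + |c|^2 ||K||^2, so u(t) = 0 for all t.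
   Since mu dV does not charge the boundary, norms over D and closure D agree.

   Evaluations being continuous, norm-Cauchy sequences of L^2_H(D, mu) converge pointwise,
   so that Fatou's lemma gives completeness without extracting subsequences. *)
Require Import Defs.
From HB Require Import structures.
From mathcomp Require Import all_boot all_order all_algebra.
From mathcomp Require Import complex ring lra.
From mathcomp Require Import all_classical all_reals all_analysis measurable_realfun.

Set Implicit Arguments.
Unset Strict Implicit.
Unset Printing Implicit Defensive.

Import Order.TTheory GRing.Theory Num.Theory.
Import numFieldNormedType.Exports.

Local Open Scope classical_set_scope.
Local Open Scope ring_scope.

(** * Lebesgue measurability of open sets, through half-spaces and boxes *)

Section measurable_open.
Context {R : realType} {N : nat}.
Notation CN := (Cvec R N.+1).
Implicit Types (a b z : CN) (A : set CN).
Local Notation Re := (@complex.Re R).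
Local Notation Im := (@complex.Im R).

(** Cutting the side [[a, b)] of a box at [c] preserves total length even when [c] lies outside or
    the side is degenerate, thanks to the truncation at 0. *)
Lemma max0_cut (a b c : R) :
  Num.max 0 (Num.min b c - a) + Num.max 0 (b - Num.max a c) = Num.max 0 (b - a).
Proof. by rewrite /Num.min /Num.max; do !case: ifPn; rewrite -?leNgt => *; lra. Qed.

(* [h] stands for a real coordinate [Re z_j] or [Im z_j]; [hi] and [lo] move one face of a
   box onto the hyperplane [h = c]. *)
Lemma measurable_halfspace (h : CN -> R) (c : R)
    (lo hi : CN -> CN -> CN) :
  (forall a b, cbox a b `&` [set z | h z < c] `<=` cbox a (hi a b)) ->
  (forall a b, cbox a b `&` ~` [set z | h z < c] `<=` cbox (lo a b) b) ->
  (forall a b, cbox_vol a (hi a b) + cbox_vol (lo a b) b = cbox_vol a b) ->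
  measurable ([set z | h z < c] : set (lebCvec R N)).
Proof.
(* Each cover of [X] by boxes is cut into covers of the two pieces of [X] with the same total
   volume, which gives the Carathéodory inequality. *)
move=> Hhi Hlo Hvol; apply: le_caratheodory_measurable => X.
apply: le_ereal_inf_tmp => _ [F XF <-].
set S1 := (\sum_(k <oo) (cbox_vol (F k).1 (hi (F k).1 (F k).2))%:E)%E.
set S2 := (\sum_(k <oo) (cbox_vol (lo (F k).1 (F k).2) (F k).2)%:E)%E.
have -> : (\sum_(k <oo) (cbox_vol (F k).1 (F k).2)%:E = S1 + S2)%E.
  rewrite -nneseriesD//; last 2 first.
  - by move=> k _ _; rewrite lee_fin cbox_vol_ge0.
  - by move=> k _ _; rewrite lee_fin cbox_vol_ge0.
  by apply: eq_eseriesr => k _; rewrite -EFinD Hvol.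
apply: leeD; apply: ereal_inf_lbound.
- exists (fun k => ((F k).1, hi (F k).1 (F k).2)) => //= z [Xz hz].
  by have [k _ Fz] := XF _ Xz; exists k => //; exact: Hhi.
- exists (fun k => (lo (F k).1 (F k).2, (F k).2)) => //= z [Xz hz].
  by have [k _ Fz] := XF _ Xz; exists k => //; exact: Hlo.
Qed.

Definition set_coord (a : CN) (j : 'I_N.+1) (x : R[i]) : CN :=
  \row_k if k == j then x else a 0 k.

Lemma set_coordE a j x k : set_coord a j x 0 k = if k == j then x else a 0 k.
Proof. by rewrite mxE. Qed.

Lemma measurable_Re_lt (j : 'I_N.+1) (c : R) :
  measurable ([set z : CN | Re (z 0 j) < c] : set (lebCvec R N)).
Proof.
pose lo (a b : CN) := set_coord a j (Complex (Num.max (Re (a 0 j)) c) (Im (a 0 j))).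
pose hi (a b : CN) := set_coord b j (Complex (Num.min (Re (b 0 j)) c) (Im (b 0 j))).
apply: (@measurable_halfspace (fun z => Re (z 0 j)) c lo hi).
- move=> a b z [zab zc] k; have /andP[/andP[? ?] /andP[? ?]] := zab k.
  rewrite set_coordE; case: eqP => [kj|_]; last exact: zab k.
  by subst k; rewrite /= lt_min; apply/andP; split; apply/andP; split=> //; apply/andP.
- move=> a b z [zab /negP]; rewrite -leNgt => zc k.
  have /andP[/andP[? ?] /andP[? ?]] := zab k.
  rewrite set_coordE; case: eqP => [kj|_]; last exact: zab k.
  by subst k; rewrite /= ge_max; apply/andP; split; apply/andP; split=> //; apply/andP.
- move=> a b; rewrite /cbox_vol (bigD1 j)//= [X in _ + X](bigD1 j)//= [RHS](bigD1 j)//=.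
  set P := (X in _ = _ * X); set P1 := (X in _ * X + _); set P2 := (X in _ + _ * X).
  have -> : P1 = P by apply: eq_bigr => k kj; rewrite /hi set_coordE (negbTE kj).
  have -> : P2 = P by apply: eq_bigr => k kj; rewrite /lo set_coordE (negbTE kj).
  rewrite !set_coordE eqxx /=.
  by rewrite -mulrDl; congr (_ * _); rewrite -mulrDl max0_cut.
Qed.

Lemma measurable_Im_lt (j : 'I_N.+1) (c : R) :
  measurable ([set z : CN | Im (z 0 j) < c] : set (lebCvec R N)).
Proof.
pose lo (a b : CN) := set_coord a j (Complex (Re (a 0 j)) (Num.max (Im (a 0 j)) c)).
pose hi (a b : CN) := set_coord b j (Complex (Re (b 0 j)) (Num.min (Im (b 0 j)) c)).
apply: (@measurable_halfspace (fun z => Im (z 0 j)) c lo hi).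
- move=> a b z [zab zc] k; have /andP[/andP[? ?] /andP[? ?]] := zab k.
  rewrite set_coordE; case: eqP => [kj|_]; last exact: zab k.
  by subst k; rewrite /= lt_min; apply/andP; split; apply/andP; split=> //; apply/andP.
- move=> a b z [zab /negP]; rewrite -leNgt => zc k.
  have /andP[/andP[? ?] /andP[? ?]] := zab k.
  rewrite set_coordE; case: eqP => [kj|_]; last exact: zab k.
  by subst k; rewrite /= ge_max; apply/andP; split; apply/andP; split=> //; apply/andP.
- move=> a b; rewrite /cbox_vol (bigD1 j)//= [X in _ + X](bigD1 j)//= [RHS](bigD1 j)//=.
  set P := (X in _ = _ * X); set P1 := (X in _ * X + _); set P2 := (X in _ + _ * X).
  have -> : P1 = P by apply: eq_bigr => k kj; rewrite /hi set_coordE (negbTE kj).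
  have -> : P2 = P by apply: eq_bigr => k kj; rewrite /lo set_coordE (negbTE kj).
  rewrite !set_coordE eqxx /=.
  by rewrite -mulrDl; congr (_ * _); rewrite -mulrDr max0_cut.
Qed.

Lemma measurable_cbox a b : measurable (cbox a b : set (lebCvec R N)).
Proof.
pose F (j : 'I_N.+1) : set (lebCvec R N) :=
  ([set z : CN | Re (z 0 j) < Re (b 0 j)] `\` [set z : CN | Re (z 0 j) < Re (a 0 j)]) `&`
  ([set z : CN | Im (z 0 j) < Im (b 0 j)] `\` [set z : CN | Im (z 0 j) < Im (a 0 j)]).
have -> : cbox a b = \bigcap_(j in [set: 'I_N.+1]) F j.
  apply/seteqP; split => z.
    move=> zab j _; have /andP[/andP[? ?] /andP[? ?]] := zab j.
    by split; split => //=; apply/negP; rewrite -leNgt.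
  move=> zF j; have := zF j I.
  rewrite /F /= => -[[-> /negP]]; rewrite -leNgt => -> [-> /negP].
  by rewrite -leNgt => ->.
apply: fin_bigcap_measurable => // j _; apply: measurableI; apply: measurableD.
- exact: measurable_Re_lt.
- exact: measurable_Re_lt.
- exact: measurable_Im_lt.
- exact: measurable_Im_lt.
Qed.

Lemma normc_ReIm_lt (w : R[i]) (r : R) :
  `|Re w| < r / 2 -> `|Im w| < r / 2 -> `|w| < r%:C%C.
Proof.
case: w => x y /= hx hy; rewrite normc_def ltcR /=.
have hr : 0 < r by have := normr_ge0 x; lra.
rewrite -(ger0_norm (ltW hr)) -sqrtr_sqr ltr_sqrt ?exprn_gt0//.
rewrite -(real_normK (num_real x)) -(real_normK (num_real y)).
have := normr_ge0 x; have := normr_ge0 y; nra.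
Qed.

(** An open set is the countable union of the boxes with rational corners that it contains. *)
Lemma open_measurable_leb A : open A -> measurable (A : set (lebCvec R N)).
Proof.
move=> oA; pose I := {ffun 'I_N.+1 -> (rat * rat) * (rat * rat)}.
pose lo (p : I) : CN := \row_j Complex (ratr (p j).1.1) (ratr (p j).2.1).
pose hi (p : I) : CN := \row_j Complex (ratr (p j).1.2) (ratr (p j).2.2).
pose B (n : nat) : set (lebCvec R N) := if unpickle n is Some p then
  (if `[< cbox (lo p) (hi p) `<=` A >] then cbox (lo p) (hi p) else set0) else set0.
have -> : A = \bigcup_n B n.
  apply/seteqP; split => [z Az|z [n _]]; last first.
    by rewrite /B; case: unpickle => [p|//]; case: ifPn => [/asboolP sA /sA|].
  have [e /= e0 zeA] : exists2 e : R[i], 0 < e & ball z e `<=` A.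
    by apply/nbhs_ballP; exact: open_nbhs_nbhs.
  (* Radii of balls live in [R[i]]; a positive element there has zero imaginary part. *)
  have [r r0 re] : exists2 r : R, 0 < r & e = r%:C%C.
    move: e0 {zeA}; case: e => x y; rewrite ltcE /= => /andP[/eqP -> x0].
    by exists x.
  (* Corners within [r / 2] of [z] keep both parts of each coordinate within [r / 2], hence the
     modulus below [r]. Lower bounds may be attained since boxes are half-open. *)
  have /choice[p Hp] : forall j : 'I_N.+1, exists q : (rat * rat) * (rat * rat),
    [/\ Re (z 0 j) - r / 2 < ratr q.1.1 <= Re (z 0 j),
        Re (z 0 j) < ratr q.1.2 < Re (z 0 j) + r / 2,
        Im (z 0 j) - r / 2 < ratr q.2.1 <= Im (z 0 j) &
        Im (z 0 j) < ratr q.2.2 < Im (z 0 j) + r / 2].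
    move=> j.
    have ratP (x y : R) : x < y -> exists q : rat, x < ratr q < y.
      by move=> /rat_in_itvoo[q]; rewrite in_itv; exists q.
    have [q1 q1P] := ratP (Re (z 0 j) - r / 2) (Re (z 0 j)) ltac:(lra).
    have [q2 q2P] := ratP (Re (z 0 j)) (Re (z 0 j) + r / 2) ltac:(lra).
    have [q3 q3P] := ratP (Im (z 0 j) - r / 2) (Im (z 0 j)) ltac:(lra).
    have [q4 q4P] := ratP (Im (z 0 j)) (Im (z 0 j) + r / 2) ltac:(lra).
    by exists ((q1, q2), (q3, q4)); split=> /=; lra.
  pose P : I := [ffun j => p j].
  exists (pickle P) => //; rewrite /B pickleK.
  have PA : cbox (lo P) (hi P) `<=` A.
    move=> w wP; apply: zeA; split=> // i j; rewrite ord1 re.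
    have [] := Hp j; have := wP j; rewrite !mxE !ffunE /=.
    move=> /andP[/andP[? ?] /andP[? ?]] /andP[? ?] /andP[? ?] /andP[? ?] /andP[? ?].
    apply: normc_ReIm_lt; rewrite raddfB /= ltr_norml; lra.
  case: ifPn => [_|/asboolPn//] j; have [] := Hp j; rewrite !mxE !ffunE /=.
  by move=> /andP[? ?] /andP[? ?] /andP[? ?] /andP[? ?]; apply/andP; split; lra.
apply: bigcupT_measurable => n; rewrite /B; case: unpickle => [p|//].
by case: ifP => // _; exact: measurable_cbox.
Qed.

End measurable_open.

(** * The real-valued modulus of complex numbers *)

Section complex_modulus.
Context {R : rcfType}.
Local Notation normc := ComplexField.Normc.normc.
Local Notation Re := (@complex.Re R).
Local Notation Im := (@complex.Im R).

Lemma normc_sqr (x : R[i]) : normc x ^+ 2 = Re x ^+ 2 + Im x ^+ 2.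
Proof. by case: x => a b /=; rewrite sqr_sqrtr// addr_ge0// sqr_ge0. Qed.

Lemma normc_ge0 (x : R[i]) : 0 <= normc x.
Proof. by case: x => a b; exact: sqrtr_ge0. Qed.

Lemma normc_ge_absRe (x : R[i]) : `|Re x| <= normc x.
Proof. by rewrite -sqrtr_sqr; case: x => a b /=; rewrite ler_wsqrtr// lerDl sqr_ge0. Qed.

Lemma normc_ge_absIm (x : R[i]) : `|Im x| <= normc x.
Proof. by rewrite -sqrtr_sqr; case: x => a b /=; rewrite ler_wsqrtr// lerDr sqr_ge0. Qed.

Lemma norm_normc (x : R[i]) : `|x| = (normc x)%:C%C.
Proof. by case: x. Qed.

Lemma ReM (x y : R[i]) : Re (x * y) = Re x * Re y - Im x * Im y.
Proof. by case: x; case: y. Qed.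

Lemma ImM (x y : R[i]) : Im (x * y) = Re x * Im y + Im x * Re y.
Proof. by case: x => a b; case: y => c d /=; ring. Qed.

(** A polynomial of degree 2 in [s], recovered from its values at 0 and 1 and its leading
    coefficient. This form lets squared norms replace scalar products throughout. *)
Lemma normc_sqrD_line (x y : R[i]) (s : R) :
  normc (x + s%:C%C * y) ^+ 2 =
  (1 - s) * normc x ^+ 2 + s * normc (x + y) ^+ 2 + (s ^+ 2 - s) * normc y ^+ 2.
Proof. by rewrite !normc_sqr !raddfD /= ReM ImM /=; ring. Qed.

Lemma normc_sqrD_le (x y : R[i]) :
  normc (x + y) ^+ 2 <= 2 * normc x ^+ 2 + 2 * normc y ^+ 2.
Proof.
rewrite !normc_sqr !raddfD /=.
have := sqr_ge0 (Re x - Re y); have := sqr_ge0 (Im x - Im y); lra.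
Qed.

End complex_modulus.

(** * Square-integrable functions for a weight on a measure space *)

Section square_integrable.
Context {R : realType} {d : measure_display} {T : measurableType d}.
Local Notation normc := (@ComplexField.Normc.normc R).
Local Notation Re := (@complex.Re R).
Local Notation Im := (@complex.Im R).
Variables (m : {measure set T -> \bar R}) (A : set T) (mu : T -> R).
Hypotheses (mA : measurable A) (mmu : measurable_fun A mu).
Hypothesis (mu_ge0 : forall z, A z -> 0 <= mu z).
Implicit Types (f g h : T -> R[i]).

(** For [m = dV], this and the next two definitions unfold to [cmeasurable_fun], [L2sqr] and [L2],
    so results transfer by conversion. *)
Definition complex_measurable f :=
  measurable_fun A (fun z => Re (f z)) /\ measurable_fun A (fun z => Im (f z)).

Definition energy f : \bar R := (\int[m]_(z in A) (normc (f z) ^+ 2 * mu z)%:E)%E.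

Definition square_integrable f := complex_measurable f /\ (energy f < +oo)%E.

Definition sqnorm f : R := fine (energy f).

Lemma sqnorm_ge0 f : 0 <= sqnorm f.
Proof.
rewrite fine_ge0//; apply: integral_ge0 => z Az.
by rewrite lee_fin mulr_ge0 ?sqr_ge0//; exact: mu_ge0.
Qed.

Lemma eq_energy f g : {in A, forall z, normc (f z) = normc (g z)} ->
  energy f = energy g.
Proof. by move=> fg; apply: eq_integral => z /fg ->. Qed.

Lemma eq_square_integrable f g : {in A, f =1 g} -> square_integrable f -> square_integrable g.
Proof.
move=> fg [[mRe mIm] foo]; split; last by rewrite -(@eq_energy f)// => z /fg ->.
by split; [apply: eq_measurable_fun mRe|apply: eq_measurable_fun mIm] => z /fg ->.
Qed.

Lemma complex_measurable_lin f g (c : R[i]) : complex_measurable f ->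
  complex_measurable g -> complex_measurable (fun z => f z + c * g z).
Proof.
move=> [mRf mIf] [mRg mIg]; split.
- rewrite (_ : (fun z => _) = (fun z => Re (f z) + (Re c * Re (g z) - Im c * Im (g z)))).
    apply: measurable_funD => //; apply: measurable_funB.
      by apply: measurable_funM => //; exact: measurable_cst.
    by apply: measurable_funM => //; exact: measurable_cst.
  by apply/funext => z; rewrite raddfD /= ReM.
- rewrite (_ : (fun z => _) = (fun z => Im (f z) + (Re c * Im (g z) + Im c * Re (g z)))).
    apply: measurable_funD => //; apply: measurable_funD.
      by apply: measurable_funM => //; exact: measurable_cst.
    by apply: measurable_funM => //; exact: measurable_cst.
  by apply/funext => z; rewrite raddfD /= ImM.
Qed.

Lemma measurable_density f : complex_measurable f ->
  measurable_fun (A : set T) (fun z => normc (f z) ^+ 2 * mu z).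
Proof.
move=> [mR mI]; rewrite (_ : (fun z => _) =
  (fun z => (Re (f z) ^+ 2 + Im (f z) ^+ 2) * mu z)); last first.
  by apply/funext => z; rewrite normc_sqr.
apply: measurable_funM; last exact: mmu.
by apply: measurable_funD; exact: measurable_funX.
Qed.

Lemma density_ge0 f z : A z -> (0 <= (normc (f z) ^+ 2 * mu z)%:E)%E.
Proof. by move=> Az; rewrite lee_fin mulr_ge0 ?sqr_ge0//; exact: mu_ge0. Qed.

Lemma integrable_density f : square_integrable f ->
  m.-integrable A (EFin \o (fun z => normc (f z) ^+ 2 * mu z)).
Proof.
move=> [mf foo]; apply/integrableP; split.
  exact/measurable_EFinP/measurable_density.
apply: le_lt_trans foo; rewrite le_eqVlt; apply/orP; left; apply/eqP.
by apply: eq_integral => z; rewrite inE => Az; rewrite gee0_abs// density_ge0.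
Qed.

Lemma square_integrable_lin f g (c : R[i]) : square_integrable f -> square_integrable g ->
  square_integrable (fun z => f z + c * g z).
Proof.
move=> Lf Lg; split; first exact: complex_measurable_lin Lf.1 Lg.1.
have mfg := measurable_density (complex_measurable_lin c Lf.1 Lg.1).
suff /integrableP[_] : m.-integrable A
    (EFin \o (fun z => normc (f z + c * g z) ^+ 2 * mu z)).
  apply: le_lt_trans; rewrite le_eqVlt; apply/orP; left; apply/eqP.
  apply: eq_integral => z; rewrite inE => Az.
  by rewrite gee0_abs// (density_ge0 (fun z => f z + c * g z)).
(* An integrable majorant, from |x + y|^2 <= 2|x|^2 + 2|y|^2. *)
pose G z := 2 * (normc (f z) ^+ 2 * mu z) + (2 * normc c ^+ 2) * (normc (g z) ^+ 2 * mu z).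
apply: (@le_integrable _ _ _ m A mA _ (EFin \o G)).
- exact/measurable_EFinP.
- move=> z Az; have mz := mu_ge0 Az.
  rewrite /= lee_fin ger0_norm; last by rewrite mulr_ge0 ?sqr_ge0.
  apply: le_trans (ler_norm _).
  have := ler_wpM2r mz (normc_sqrD_le (f z) (c * g z)).
  by rewrite ComplexField.Normc.normcM exprMn /G => /le_trans; apply; lra.
- have := integrableD mA (integrableZl mA 2 (integrable_density Lf))
    (integrableZl mA (2 * normc c ^+ 2) (integrable_density Lg)).
  exact.
Qed.

Lemma sqnormZ f (c : R[i]) : square_integrable f ->
  sqnorm (fun z => c * f z) = normc c ^+ 2 * sqnorm f.
Proof.
move=> Lf; have := RintegralZl (normc c ^+ 2) mA (integrable_density Lf).
rewrite /sqnorm /energy /Rintegral => <-; congr fine; apply: eq_integral => z _.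
by rewrite ComplexField.Normc.normcM exprMn -mulrA.
Qed.

(** Integrated form of [normc_sqrD_line]. The number [sqnorm (f \+ g) - sqnorm f - sqnorm g] stands
    for 2 Re <f|g>. *)
Lemma sqnorm_line f g (s : R) : square_integrable f -> square_integrable g ->
  sqnorm (fun z => f z + s%:C%C * g z) =
  (1 - s) * sqnorm f + s * sqnorm (f \+ g) + (s ^+ 2 - s) * sqnorm g.
Proof.
move=> Lf Lg; have Lfg : square_integrable (f \+ g).
  by apply: eq_square_integrable (square_integrable_lin 1 Lf Lg) => z _; rewrite mul1r.
have If := integrable_density Lf; have Ig := integrable_density Lg.
have Ifg := integrable_density Lfg.
have Zl (k : R) (u : T -> R) (Iu : m.-integrable A (EFin \o u)) :
    m.-integrable A (EFin \o (fun z => k * u z)).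
  exact: (integrableZl mA k Iu).
have Dd (u v : T -> R) (Iu : m.-integrable A (EFin \o u))
    (Iv : m.-integrable A (EFin \o v)) :
    m.-integrable A (EFin \o (fun z => u z + v z)).
  exact: (integrableD mA Iu Iv).
have E h : sqnorm h = Rintegral m A (fun z => normc (h z) ^+ 2 * mu z) by [].
rewrite !E -(RintegralZl _ mA If) -(RintegralZl _ mA Ifg) -(RintegralZl _ mA Ig).
rewrite -(RintegralD mA (Zl _ _ If) (Zl _ _ Ifg)).
rewrite -(RintegralD mA (Dd _ _ (Zl _ _ If) (Zl _ _ Ifg)) (Zl _ _ Ig)).
by apply: eq_Rintegral => z _ /=; rewrite normc_sqrD_line; ring.
Qed.

Lemma energyE f : square_integrable f -> energy f = (sqnorm f)%:E.
Proof.
move=> [_ foo]; rewrite fineK// ge0_fin_numE//.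
by apply: integral_ge0 => z Az; exact: density_ge0.
Qed.

Lemma eq_ae_energyB f g h :
  complex_measurable (f \- h) -> complex_measurable (g \- h) ->
  {ae m, forall z, A z -> f z = g z} -> energy (f \- h) = energy (g \- h).
Proof.
move=> mf mg fg; apply: ae_eq_integral => //.
- exact/measurable_EFinP/measurable_density.
- exact/measurable_EFinP/measurable_density.
- by apply: filterS fg => z fg Az; rewrite /= fg.
Qed.

(** Fatou's lemma: the energy is lower semicontinuous under pointwise convergence. *)
Lemma energy_cvg_le (u : nat -> T -> R[i]) v (M : R) :
  (forall n, complex_measurable (u n)) ->
  (forall z, A z -> (fun n => Re (u n z)) @ \oo --> Re (v z)) ->
  (forall z, A z -> (fun n => Im (u n z)) @ \oo --> Im (v z)) ->
  (\forall n \near \oo, (energy (u n) <= M%:E)%E) ->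
  complex_measurable v /\ (energy v <= M%:E)%E.
Proof.
move=> mu_ cRe cIm uM; split.
  split.
  - by apply: (@measurable_fun_cvg _ _ _ _ (fun n z => Re (u n z))) cRe => n; case: (mu_ n).
  - by apply: (@measurable_fun_cvg _ _ _ _ (fun n z => Im (u n z))) cIm => n; case: (mu_ n).
have mdu n : measurable_fun A (fun z => (normc (u n z) ^+ 2 * mu z)%:E).
  exact/measurable_EFinP/measurable_density.
have du0 n z : A z -> (0 <= (normc (u n z) ^+ 2 * mu z)%:E)%E by exact: density_ge0.
have limE : {in A, forall z, (normc (v z) ^+ 2 * mu z)%:E =
    limn_einf (fun n => (normc (u n z) ^+ 2 * mu z)%:E)}.
  move=> z; rewrite inE => Az.
  have H : (fun n => (normc (u n z) ^+ 2 * mu z)%:E) @ \oo -->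
      (normc (v z) ^+ 2 * mu z)%:E.
    apply: cvg_EFin; first by near=> n.
    rewrite normc_sqr (_ : _ \o _ =
      (fun n => (Re (u n z) ^+ 2 + Im (u n z) ^+ 2) * mu z)); last first.
      by apply/funext => n /=; rewrite normc_sqr.
    apply: cvgM; last exact: cvg_cst.
    by rewrite !expr2; under eq_fun do rewrite !expr2; apply: cvgD; apply: cvgM;
      [exact: cRe|exact: cRe|exact: cIm|exact: cIm].
  by have [-> _] := cvg_limn_einf_sup H.
rewrite /energy (eq_integral _ _ limE); apply: le_trans (fatou m mA mdu du0) _.
rewrite limn_einf_lim; apply: lime_le; first exact: is_cvg_einfs.
(* The bound holds only from [k] on, so the infimum of the tail starting at [n] is compared with its
   term of index [maxn n k]. *)
case: uM => k _ uM; near=> n; apply: (@le_trans _ _ (energy (u (maxn n k)))).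
  by apply: ereal_inf_lbound; exists (maxn n k) => //=; exact: leq_maxl.
by apply: uM => /=; exact: leq_maxr.
Unshelve. all: by end_near. Qed.

(** The limit is taken pointwise, separately on real and imaginary parts; Fatou's lemma, applied to
    [s k \- s n] as [k] grows with [n] fixed, turns it into a limit in norm. *)
Lemma pointwise_cauchy_complete (s : nat -> T -> R[i]) :
  (forall n, square_integrable (s n)) ->
  (forall e : R, 0 < e -> exists M, forall k n, (M <= k)%N -> (M <= n)%N ->
     sqnorm (s k \- s n) <= e) ->
  (forall z, A z -> forall e : R, 0 < e -> exists M, forall k n,
     (M <= k)%N -> (M <= n)%N -> normc (s k z - s n z) < e) ->
  exists2 g, square_integrable g &
    forall e : R, 0 < e -> exists M, forall n, (M <= n)%N -> sqnorm (g \- s n) <= e.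
Proof.
move=> Ls Cs Ps.
have cvg_part (p : {additive R[i] -> R}) : (forall x, `|p x| <= normc x) ->
    forall z, A z -> cvgn (fun n => p (s n z)).
  move=> ple z Az; apply/cauchy_cvgP; apply: cauchy_exP => e e0.
  have [M HM] := Ps z Az e e0; exists (p (s M z)); exists M => // n /= Mn.
  by rewrite /ball /= -raddfB; apply: le_lt_trans (ple _) _; exact: HM.
pose g (z : T) : R[i] :=
  Complex (limn (fun n => Re (s n z)) : R) (limn (fun n => Im (s n z)) : R).
have bound (e : R) : 0 < e -> exists M, forall n, (M <= n)%N ->
    square_integrable (g \- s n) /\ sqnorm (g \- s n) <= e.
  move=> e0; have [M HM] := Cs e e0; exists M => n Mn.
  have Lsn k : square_integrable (s k \- s n).
    by apply: eq_square_integrable (square_integrable_lin (-1) (Ls k) (Ls n)) => z _;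
      rewrite mulN1r.
  have [mg gle] : complex_measurable (g \- s n) /\ (energy (g \- s n)%R <= e%:E)%E.
    apply: (@energy_cvg_le (fun k => s k \- s n)) => [k|z Az|z Az|].
    - by case: (Lsn k).
    - rewrite [X in _ --> X]raddfB /=; under eq_fun do rewrite raddfB.
      by apply: cvgB; [exact: (cvg_part Re (@normc_ge_absRe _))|exact: cvg_cst].
    - rewrite [X in _ --> X]raddfB /=; under eq_fun do rewrite raddfB.
      by apply: cvgB; [exact: (cvg_part Im (@normc_ge_absIm _))|exact: cvg_cst].
    - exists M => // k /= Mk.
      by rewrite energyE// lee_fin; exact: HM.
  have Lg : square_integrable (g \- s n).
    by split => //; apply: le_lt_trans gle _; rewrite ltry.
  by split => //; rewrite -lee_fin -energyE.
exists g => [|e /bound[M HM]]; last by exists M => n /HM[].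
(* Any tolerance would do: [g] is the sum of [g \- s M] and [s M], both square integrable. *)
have [M /(_ M (leqnn M))[Lg _]] := bound 1 ltr01.
apply: eq_square_integrable (square_integrable_lin 1 Lg (Ls M)) => z _.
by rewrite mul1r /= subrK.
Qed.

End square_integrable.

(** * Two limiting arguments on real numbers *)

Lemma quadratic_ge0_linear0 (R : realFieldType) (b w : R) :
  0 <= w -> (forall s : R, 0 <= s * b + s ^+ 2 * w) -> b = 0.
Proof.
move=> w0 H; have w1 : 0 < w + 1 by lra.
(* The quadratic takes the value -(b / (w + 1))^2 at this point; [w + 1] rather than [w] keeps the
   denominator nonzero. *)
have := H (- b / (w + 1)).
rewrite (_ : _ + _ = - (b / (w + 1)) ^+ 2); last by field; lra.
rewrite oppr_ge0 => h.
have /eqP : (b / (w + 1)) ^+ 2 = 0 by apply/eqP; rewrite eq_le h sqr_ge0.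
by rewrite sqrf_eq0 mulf_eq0 invr_eq0 => /orP[/eqP//|/eqP]; lra.
Qed.

(** Let [e], then [s], tend to 0. The hypothesis has the shape produced by [wsqnormD_le] for a sum
    of a term of squared norm at most [a + e] and a term of squared norm at most [e]. *)
Lemma le_of_split (R : realFieldType) (a b : R) : 0 <= a ->
  (forall s e : R, 0 < s -> 0 < e -> b <= (1 + s) * (a + e) + (1 + s^-1) * e) ->
  b <= a.
Proof.
move=> a0 H.
have H1 s : 0 < s -> b <= (1 + s) * a.
  move=> s0; apply/ler_addgt0Pr => n n0.
  have si : 0 < s^-1 by rewrite invr_gt0.
  have k0 : 0 < (1 + s) + (1 + s^-1) by lra.
  have := H s (n / ((1 + s) + (1 + s^-1))) s0 (divr_gt0 n0 k0).
  rewrite mulrDr -addrA -mulrDl mulrC (mulrC (_ + _) (n / _)) -mulrA.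
  by rewrite mulVf ?gt_eqF// mulr1 mulrC.
apply/ler_addgt0Pr => n n0.
have a1 : 0 < a + 1 by lra.
apply: le_trans (H1 _ (divr_gt0 n0 a1)) _.
rewrite mulrDl mul1r lerD2l mulrAC ler_pdivrMr// ler_pM2l//; lra.
Qed.

(** * Algebra of squared norms in L^2(A, mu) *)

Section weighted_L2.
Context {R : realType} {N : nat}.
Notation CN := (Cvec R N.+1).
Local Notation normc := (@ComplexField.Normc.normc R).
Local Notation Re := (@complex.Re R).
Local Notation Im := (@complex.Im R).
Variables (A : set CN) (mu : CN -> R).
Hypotheses (mA : measurable (A : set (lebCvec R N))) (wmu : weight A mu).
Implicit Types (f g h : CN -> R[i]).

Local Notation q := (sqnorm (@dV R N) A mu).

Lemma weight_ge0 z : A z -> 0 <= mu z.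
Proof. by move=> /wmu.2/ltW. Qed.

Lemma wsqnorm_ge0 f : 0 <= q f.
Proof. by apply: sqnorm_ge0; exact: weight_ge0. Qed.

Lemma L2normE f : L2norm A mu f = Num.sqrt (q f).
Proof. by []. Qed.

Lemma L2norm_lt f (e : R) : 0 < e -> (L2norm A mu f < e) = (q f < e ^+ 2).
Proof.
move=> e0; rewrite L2normE -{1}(ger0_norm (ltW e0)) -sqrtr_sqr.
by rewrite ltr_sqrt// exprn_gt0.
Qed.

Lemma eq_sqnorm f g : {in A, f =1 g} -> q f = q g.
Proof. by move=> fg; congr fine; apply: eq_energy => z /fg ->. Qed.

Lemma L2_lin f g (c : R[i]) : L2 A mu f -> L2 A mu g ->
  L2 A mu (fun z => f z + c * g z).
Proof. exact: (square_integrable_lin mA wmu.1 weight_ge0). Qed.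

Lemma L2B f g : L2 A mu f -> L2 A mu g -> L2 A mu (f \- g).
Proof.
move=> Lf Lg; rewrite (_ : _ \- _ = fun z => f z + (-1) * g z); first exact: L2_lin.
by apply/funext => z; rewrite mulN1r.
Qed.

Lemma L2sqr0 : L2sqr A mu (fun=> 0) = 0%E.
Proof.
rewrite /L2sqr; under eq_integral do rewrite /= expr0n/= addr0 sqrtr0 expr0n/= mul0r.
exact: integral0.
Qed.

Lemma wsqnorm0 : q (fun=> 0) = 0.
Proof. by rewrite [LHS](congr1 fine L2sqr0). Qed.

Lemma L2_0 : L2 A mu (fun=> 0).
Proof. by split; [split; exact: measurable_cst|rewrite L2sqr0 ltry]. Qed.

Lemma wsqnormZ f (c : R[i]) : L2 A mu f -> q (fun z => c * f z) = normc c ^+ 2 * q f.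
Proof. exact: (sqnormZ mA wmu.1 weight_ge0). Qed.

Lemma wsqnorm_line f g (s : R) : L2 A mu f -> L2 A mu g ->
  q (fun z => f z + s%:C%C * g z) = (1 - s) * q f + s * q (f \+ g) + (s ^+ 2 - s) * q g.
Proof. exact: (sqnorm_line mA wmu.1 weight_ge0). Qed.

Lemma wsqnormBC f g : L2 A mu f -> L2 A mu g -> q (f \- g) = q (g \- f).
Proof.
move=> Lf Lg; have := wsqnormZ (-1) (L2B Lg Lf).
rewrite normc_sqr !raddfN/= sqrrN expr1n oppr0 expr0n addr0 mul1r => <-.
by apply: eq_sqnorm => z _; rewrite /= mulN1r opprB.
Qed.

(** The parallelogram law, read off from [wsqnorm_line] at [s = -1]. *)
Lemma wsqnormB f g : L2 A mu f -> L2 A mu g ->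
  q (f \- g) = 2 * q f + 2 * q g - q (f \+ g).
Proof.
move=> Lf Lg; have := wsqnorm_line (-1) Lf Lg.
rewrite (@eq_sqnorm (fun z => f z + (-1)%:C%C * g z) (f \- g)) => [->|z _]; first by ring.
by rewrite raddfN/= mulN1r.
Qed.

(** Expand 0 <= q(f - g/s) and multiply by [s]. It replaces the triangle inequality at the level of
    squared norms. *)
Lemma wsqnormD_le f g (s : R) : 0 < s -> L2 A mu f -> L2 A mu g ->
  q (f \+ g) <= (1 + s) * q f + (1 + s^-1) * q g.
Proof.
move=> s0 Lf Lg; have := wsqnorm_ge0 (fun z => f z + (- s^-1)%:C%C * g z).
rewrite wsqnorm_line// => H; have si : 0 < s^-1 by rewrite invr_gt0.
have := mulr_ge0 (ltW s0) H.
rewrite (_ : s * _ = (1 + s) * q f + (1 + s^-1) * q g - q (f \+ g)); first by lra.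
by field; lra.
Qed.

(** Minimality at [s = 0] kills the linear coefficient q(f + g) - q f - q g, that is, 2 Re <f|g>. *)
Lemma minimal_pythagoras f g : L2 A mu f -> L2 A mu g ->
  (forall s : R, q f <= q (fun z => f z + s%:C%C * g z)) ->
  q (f \+ g) = q f + q g.
Proof.
move=> Lf Lg H; apply/eqP; rewrite -subr_eq0; apply/eqP.
apply: (@quadratic_ge0_linear0 _ _ (q g)) => [|s]; first exact: wsqnorm_ge0.
by have := H s; rewrite wsqnorm_line//; lra.
Qed.

End weighted_L2.

(** * The weighted Bergman space: completeness, projections, reproducing kernel *)

Section bergman_space.
Context {R : realType} {N : nat}.
Notation CN := (Cvec R N.+1).
Local Notation normc := (@ComplexField.Normc.normc R).
Local Notation Re := (@complex.Re R).
Local Notation Im := (@complex.Im R).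
Implicit Types (f g h : CN -> R[i]).

Lemma holomorphic_lin (U : set CN) f g (c : R[i]) :
  holomorphic U f -> holomorphic U g -> holomorphic U (fun z => f z + c * g z).
Proof.
move=> hf hg z Uz; apply: differentiableD; first exact: hf.
by apply: differentiableZ; exact: hg.
Qed.

Lemma holomorphic_cst (U : set CN) (c : R[i]) : holomorphic U (fun=> c).
Proof. by move=> z _; exact: differentiable_cst. Qed.

Variables (D : set CN) (mu : CN -> R).
Hypotheses (oD : open D) (AWmu : AW D mu).

Local Notation q := (sqnorm (@dV R N) D mu).

Let mD := open_measurable_leb oD.

Lemma AW_weight : weight D mu. Proof. by case: AWmu. Qed.

Let wmu := AW_weight.

Lemma L2H_lin f g (c : R[i]) : L2H D mu f -> L2H D mu g ->
  L2H D mu (fun z => f z + c * g z).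
Proof.
by move=> [Lf hf] [Lg hg]; split; [exact: L2_lin|exact: holomorphic_lin].
Qed.

Lemma L2H0 : L2H D mu (fun=> 0).
Proof. by split; [exact: L2_0|exact: holomorphic_cst]. Qed.

Lemma L2HZ f (c : R[i]) : L2H D mu f -> L2H D mu (fun z => c * f z).
Proof.
move=> Lf; rewrite (_ : (fun z => _) = fun z => 0 + c * f z).
  exact: L2H_lin L2H0 Lf.
by apply/funext => z; rewrite add0r.
Qed.

Lemma L2HB f g : L2H D mu f -> L2H D mu g -> L2H D mu (f \- g).
Proof.
move=> Lf Lg; rewrite (_ : _ \- _ = fun z => f z + (-1) * g z); first exact: L2H_lin.
by apply/funext => z; rewrite mulN1r.
Qed.

(** Continuity at 0 with tolerance 1 gives [d]. If the bound with C = 1/d^2 failed for [g], then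
    g/g(t) would have norm below [d] and value 1 at [t]. *)
Lemma eval_bounded t : D t -> exists2 C : R, 0 < C &
  forall g, L2H D mu g -> normc (g t) ^+ 2 <= C * q g.
Proof.
move=> Dt; have [_ _ /(_ t Dt) ev] := AWmu.
have [d d0 Hd] := ev _ L2H0 1 ltr01.
exists (d ^+ 2)^-1 => [|g Lg]; first by rewrite invr_gt0 exprn_gt0.
rewrite leNgt; apply/negP => H.
have qg0 : 0 <= q g by exact: wsqnorm_ge0.
have a0 : 0 < normc (g t) ^+ 2.
  by apply: le_lt_trans H; rewrite mulr_ge0// invr_ge0 sqr_ge0.
have gt0 : g t != 0.
  by apply: contraTneq a0 => ->; rewrite /= expr0n/= addr0 sqrtr0 expr0n/= ltxx.
pose v z := (g t)^-1 * g z.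
have Lv : L2H D mu v by exact: L2HZ.
have := Hd v Lv; rewrite /v mulVf// subr0.
rewrite (_ : normc 1 = 1); last by rewrite /= expr0n/= addr0 expr1n sqrtr1.
rewrite ltxx L2norm_lt// => Hv; suff /Hv : q (v \- (fun=> 0)) < d ^+ 2 by [].
rewrite (@eq_sqnorm _ _ _ _ _ v) => [|z _]; last by rewrite /= subr0.
rewrite (wsqnormZ mD wmu _ Lg.1) ComplexField.Normc.normcV.
rewrite exprVn mulrC ltr_pdivrMr//.
by move: H; rewrite mulrC ltr_pdivrMr ?exprn_gt0// mulrC.
Qed.

Lemma eval_eq0 g t : L2H D mu g -> D t -> q g = 0 -> g t = 0.
Proof.
move=> Lg /eval_bounded[C C0 /(_ g Lg)] + qg0.
rewrite qg0 mulr0 => H; apply: ComplexField.Normc.eq0_normc.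
by apply/eqP; rewrite -sqrf_eq0 eq_le H sqr_ge0.
Qed.

(** Bounded evaluations make the sequence pointwise Cauchy, so it has a limit in L^2. Admissibility
    then supplies a holomorphic function equal to that limit almost everywhere. *)
Lemma L2H_complete (s : nat -> CN -> R[i]) :
  (forall n, L2H D mu (s n)) ->
  (forall e : R, 0 < e -> exists M, forall k n, (M <= k)%N -> (M <= n)%N ->
     q (s k \- s n) <= e) ->
  exists2 h, L2H D mu h &
    forall e : R, 0 < e -> exists M, forall n, (M <= n)%N -> q (h \- s n) <= e.
Proof.
move=> Ls Cs.
have [g Lg gs] : exists2 g, L2 D mu g &
    forall e : R, 0 < e -> exists M, forall n, (M <= n)%N -> q (g \- s n) <= e.
  apply: (pointwise_cauchy_complete mD wmu.1 (weight_ge0 wmu)) => [n||z Dz e e0].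
  - by case: (Ls n).
  - exact: Cs.
  have [C C0 HC] := eval_bounded Dz.
  have e2 : 0 < e ^+ 2 / (2 * C) by rewrite divr_gt0 ?exprn_gt0 ?mulr_gt0.
  have [M HM] := Cs _ e2; exists M => k n Mk Mn.
  have := HC _ (L2HB (Ls k) (Ls n)) => /= H.
  have /(ler_wpM2l (ltW C0)) := HM k n Mk Mn => /(le_trans H){}H.
  rewrite -(@ltr_pXn2r _ 2)// ?nnegrE ?normc_ge0 ?(ltW e0)//.
  apply: le_lt_trans H _.
  rewrite (_ : C * _ = e ^+ 2 / 2); last by field; lra.
  by have := exprn_gt0 2 e0; lra.
have [_ /(_ g Lg) cl _] := AWmu.
have [|h Lh gh] := cl.
  move=> e e0; have e2 : 0 < e ^+ 2 / 2 by rewrite divr_gt0 ?exprn_gt0.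
  have [M /(_ M (leqnn M)) HM] := gs _ e2; exists (s M) => //.
  by rewrite L2norm_lt//; apply: le_lt_trans HM _; lra.
exists h => // e /gs[M HM]; exists M => n /HM; apply: le_trans.
rewrite le_eqVlt; apply/orP; left; apply/eqP; congr fine; apply/esym.
apply: (eq_ae_energyB mD wmu.1 _ _ gh).
- by case: (L2B mD wmu Lg (Ls n).1).
- by case: (L2B mD wmu Lh.1 (Ls n).1).
Qed.

(** The limit [h] of a minimizing sequence may lie outside [C], so the sequence itself is returned.
    It serves both for the minimal function at a point and for the distance to H(closure D, mu). *)
Lemma L2H_projection (C : set (CN -> R[i])) f : C !=set0 -> C `<=` L2H D mu ->
  (forall g h, C g -> C h -> C (fun z => 2^-1 * (g z + h z))) -> L2H D mu f ->
  exists (s : nat -> CN -> R[i]) h, [/\ forall n, C (s n), L2H D mu h,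
    forall e : R, 0 < e -> exists M, forall n, (M <= n)%N -> q (h \- s n) <= e &
    forall g, C g -> q (f \- h) <= q (f \- g)].
Proof.
move=> [g0 Cg0] CL Cmid Lf.
pose Q := [set q (f \- g) | g in C].
have infQ : has_inf Q.
  by split; [exists (q (f \- g0)), g0|exists 0 => _ [g _ <-]; exact: wsqnorm_ge0].
pose d := inf Q.
have dle g : C g -> d <= q (f \- g).
  by move=> Cg; apply: ge_inf; [exact: infQ.2|exists g].
have /choice[s Hs] n : exists g, C g /\ q (f \- g) < d + n.+1%:R^-1.
  have := @inf_adherent _ Q n.+1%:R^-1; rewrite invr_gt0 ltr0n => /(_ isT infQ).
  by move=> [_ [g Cg <-] Hg]; exists g.
have Ls n : L2H D mu (s n) by exact: CL (Hs n).1.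
have inv_le (e : R) : 0 < e -> exists M, forall n, (M <= n)%N -> n.+1%:R^-1 <= e.
  move=> e0; exists (Num.truncn e^-1) => n Mn.
  rewrite invf_ple ?posrE//; apply: le_trans (ltW (truncnS_gt _)) _.
  by rewrite ler_nat ltnS.
have cauchy_s (e : R) : 0 < e -> exists M, forall k n, (M <= k)%N -> (M <= n)%N ->
    q (s k \- s n) <= e.
  (* With both squared distances below d + e/4 and that of the midpoint at least [d], the
     parallelogram law gives 2(d + e/4) + 2(d + e/4) - 4d = e. *)
  move=> e0; have e4 : 0 < e / 4 by rewrite divr_gt0.
  have [M HM] := inv_le _ e4; exists M => k n Mk Mn.
  have Lk := (L2HB Lf (Ls k)).1; have Ln := (L2HB Lf (Ls n)).1.
  have := wsqnormB mD wmu Ln Lk.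
  rewrite (@eq_sqnorm _ _ _ _ _ (s k \- s n)) => [->|z _]; last by rewrite /=; ring.
  have Cm := Cmid _ _ (Hs n).1 (Hs k).1.
  rewrite (@eq_sqnorm _ _ _ _ ((f \- s n) \+ (f \- s k))
    (fun z => 2 * (f z - 2^-1 * (s n z + s k z)))); last first.
    move=> z _ /=; rewrite mulrBr mulrA mulfV ?pnatr_eq0// mul1r.
    by rewrite mulr_natl mulr2n opprD addrACA.
  rewrite (wsqnormZ mD wmu _ (L2HB Lf (CL _ Cm)).1).
  rewrite (_ : normc 2 ^+ 2 = 4); last first.
    by rewrite normc_sqr !raddfMn/= mul0rn expr0n/= addr0; ring.
  have dm := dle _ Cm.
  have := (Hs n).2; have := (Hs k).2; have := HM k Mk; have := HM n Mn.
  move: dm; move: (n.+1%:R^-1) (k.+1%:R^-1) => x y; move: (q _) (q _) (q _) => q1 q2 q3; lra.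
have [h Lh hs] := L2H_complete Ls cauchy_s.
exists s, h; split=> //; first by move=> n; exact: (Hs n).1.
move=> g Cg; apply: le_trans (dle _ Cg).
have d0 : 0 <= d.
  by apply: lb_le_inf; [exact: infQ.1|move=> _ [g' _ <-]; exact: wsqnorm_ge0].
(* Split f - h as (f - s n) + (s n - h), of squared norms at most [d + e] and [e] for large [n]. *)
apply: le_of_split d0 _ => r e r0 e0.
have [M1 HM1] := hs e e0; have [M2 HM2] := inv_le e e0.
pose n := maxn M1 M2.
have Lsh := (L2HB (Ls n) Lh).1.
rewrite (@eq_sqnorm _ _ _ _ _ ((f \- s n) \+ (s n \- h))) => [|z _]; last first.
  by rewrite /= addrA subrK.
apply: le_trans (wsqnormD_le mD wmu r0 (L2HB Lf (Ls n)).1 Lsh) _.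
have ri : 0 < r^-1 by rewrite invr_gt0.
apply: lerD.
  rewrite ler_pM2l; last lra.
  by apply: ltW; apply: lt_le_trans (Hs n).2 _; rewrite lerD2l; exact: HM2 (leq_maxr _ _).
rewrite ler_pM2l; last lra.
by rewrite (wsqnormBC mD wmu (Ls n).1 Lh.1); exact: HM1 (leq_maxl _ _).
Qed.

Lemma eval_limit (s : nat -> CN -> R[i]) h t a : (forall n, L2H D mu (s n)) ->
  L2H D mu h ->
  (forall e : R, 0 < e -> exists M, forall n, (M <= n)%N -> q (h \- s n) <= e) ->
  D t -> (forall n, s n t = a) -> h t = a.
Proof.
move=> Ls Lh hs Dt sa; have [C C0 HC] := eval_bounded Dt.
apply/eqP; rewrite -subr_eq0; apply/eqP/ComplexField.Normc.eq0_normc.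
apply/eqP; rewrite -sqrf_eq0 eq_le sqr_ge0 andbT.
apply/ler_addgt0Pr => e e0; rewrite add0r.
have [M /(_ M (leqnn M)) HM] := hs _ (divr_gt0 e0 C0).
have := HC _ (L2HB Lh (Ls M)); rewrite /= sa => /le_trans; apply.
by rewrite mulrC -ler_pdivlMr.
Qed.

(** The minimal function is the projection of 0 on the normalized class; by [eval_limit] the
    normalization survives the passage to the limit. *)
Lemma minimal_funP t : D t -> normalized_at D mu t !=set0 ->
  minimal_at D mu t (minimal_fun D mu t).
Proof.
move=> Dt ne; apply: xgetPex.
have qN g : L2H D mu g -> q ((fun=> 0) \- g) = q g.
  move=> Lg; rewrite (wsqnormBC mD wmu L2H0.1 Lg.1).
  by apply: eq_sqnorm => z _; rewrite /= subr0.
have [||| s [h [Cs Lh hs hmin]]] := @L2H_projection (normalized_at D mu t) (fun=> 0) ne.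
- by move=> g [].
- move=> g h [Lg gt] [Lh ht]; split; last first.
    by rewrite gt ht -[X in X + X]/(1%:R) -natrD mulVf// pnatr_eq0.
  rewrite (_ : (fun z => _) = fun z => 2^-1 * (g z + 1 * h z)).
    exact/L2HZ/L2H_lin.
  by apply/funext => z; rewrite mul1r.
- exact: L2H0.
exists h; split; first split=> //.
  exact: (eval_limit (fun n => (Cs n).1) Lh hs Dt (fun n => (Cs n).2)).
move=> g Cg; rewrite !L2normE ler_wsqrtr//.
by have := hmin _ Cg; rewrite (qN _ Lh) (qN _ Cg.1).
Qed.

(** The cross term is 2 Re (conj c * g(t)), so the identity is the reproducing property g(t) = <g|K>
    in a form without scalar products. *)
Lemma bergman_kernel_reproducing t : D t ->
  let K z := bergman_kernel D mu z t in
  L2H D mu K /\ forall g c, L2H D mu g ->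
    q (fun z => g z + c * K z) =
    q g + 2 * (Re c * Re (g t) + Im c * Im (g t)) + normc c ^+ 2 * q K.
Proof.
move=> Dt K; have [ne|/asboolPn/negbTE em] := pselect (normalized_at D mu t !=set0);
  last first.
  have K0 : K = fun=> 0 by apply/funext => z; rewrite /K /bergman_kernel em.
  rewrite K0; split=> [|g c Lg]; first exact: L2H0.
  (* A function of the space not vanishing at [t] could be normalized there. *)
  have -> : g t = 0.
    apply/eqP; apply: contraFT em => gt; apply/asboolP.
    by exists (fun z => (g t)^-1 * g z); split; [exact: L2HZ|rewrite mulVf].
  rewrite (_ : (fun z => g z + c * 0) = g); last by apply/funext => z; rewrite mulr0 addr0.
  rewrite wsqnorm0.
  by rewrite /= !(mulr0, addr0).
have [[Lm mt] mmin] := minimal_funP Dt ne.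
set m := minimal_fun D mu t in Lm mt mmin.
have Q0 : 0 < q m.
  rewrite lt_neqAle wsqnorm_ge0 ?andbT; last exact: wmu.
  apply/negP => /eqP/esym/(eval_eq0 Lm Dt); rewrite mt => /eqP.
  by rewrite oner_eq0.
pose k := (q m)^-1.
have mE : L2norm D mu m ^+ 2 = q m by rewrite L2normE sqr_sqrtr// ltW.
have KE : K = fun z => k%:C%C * m z.
  apply/funext => z; rewrite /K /bergman_kernel; move/asboolP : (ne) => ->.
  rewrite -/m mE mulrC; congr (_ * _).
  exact: (esym (fmorphV (real_complex R) (q m))).
(* Adding a multiple of [v] keeps the value 1 at [t], so minimality makes [m] orthogonal to all
   functions vanishing at [t]. *)
have pyth1 v : L2H D mu v -> v t = 0 -> q (m \+ v) = q m + q v.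
  move=> Lv v0; apply: (minimal_pythagoras mD wmu Lm.1 Lv.1) => s.
  have /mmin : normalized_at D mu t (fun z => m z + s%:C%C * v z).
    by split; [exact: L2H_lin|rewrite v0 mulr0 addr0].
  by rewrite !L2normE ler_sqrt// wsqnorm_ge0//; exact: wmu.
have pyth v a : L2H D mu v -> v t = 0 ->
    q (fun z => v z + a * m z) = q v + normc a ^+ 2 * q m.
  move=> Lv v0; have [->|a0] := eqVneq a 0.
    rewrite normc_sqr /= expr0n/= addr0 mul0r addr0.
    by apply: eq_sqnorm => z _; rewrite mul0r addr0.
  rewrite (@eq_sqnorm _ _ _ _ _ (fun z => a * (m z + a^-1 * v z))); last first.
    by move=> z _; rewrite mulrDr mulrA mulfV// mul1r addrC.
  rewrite (wsqnormZ mD wmu _ (L2H_lin _ Lm Lv).1).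
  rewrite (pyth1 (fun z => a^-1 * v z)); [|exact: L2HZ|by rewrite v0 mulr0].
  rewrite (wsqnormZ mD wmu _ Lv.1) ComplexField.Normc.normcV mulrDr mulrA -exprMn.
  rewrite mulfV ?expr1n ?mul1r 1?addrC//.
  by apply: contra_neq a0; exact: ComplexField.Normc.eq0_normc.
split=> [|g c Lg]; first by rewrite KE; exact: L2HZ.
(* Both [g] and g + c K are [v] plus a multiple of [m], with coefficients g(t) and g(t) + c k;
   Pythagoras applies to each. *)
pose v z := g z + (- g t) * m z.
have Lv : L2H D mu v by exact: L2H_lin.
have v0 : v t = 0 by rewrite /v mt mulr1 subrr.
have -> : q g = q v + normc (g t) ^+ 2 * q m.
  by rewrite -pyth//; apply: eq_sqnorm => z _; rewrite /v mulNr subrK.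
have -> : q (fun z => g z + c * K z) = q v + normc (g t + c * k%:C%C) ^+ 2 * q m.
  by rewrite -pyth//; apply: eq_sqnorm => z _; rewrite /v KE; ring.
rewrite KE (wsqnormZ mD wmu _ Lm.1) !normc_sqr !raddfD/= ReM ImM /= /k.
by field; rewrite gt_eqF.
Qed.

End bergman_space.

(** * Passage between D and its closure *)

Section boundary.
Context {R : realType} {N : nat}.
Notation CN := (Cvec R N.+1).
Local Notation leb := (lebCvec R N).
Local Notation normc := (@ComplexField.Normc.normc R).
Implicit Types (f g h : CN -> R[i]).

(** A positive weight with zero integral forces [B] to be a null set, so every integral over [B]
    vanishes. *)
Lemma energy_null_weight (B : set CN) (mu : CN -> R) f : measurable (B : set leb) ->
  weight B mu -> cmeasurable_fun B f ->
  (\int[dV]_(z in (B : set leb)) (mu z)%:E = 0)%E -> L2sqr B mu f = 0%E.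
Proof.
move=> mB wB mf mu0.
have mmu : measurable_fun (B : set leb) (fun z : leb => (mu z)%:E).
  exact/measurable_EFinP/wB.1.
have mdens : measurable_fun (B : set leb) (fun z : leb => (normc (f z) ^+ 2 * mu z)%:E).
  by apply/measurable_EFinP; exact: (measurable_density wB.1 mf).
have B0 : ae_eq (@dV R N) (B : set leb) (fun z : leb => (mu z)%:E) (cst 0%E).
  apply/(ae_eq_integral_abs _ mB mmu); rewrite -[RHS]mu0.
  apply: eq_integral => z; rewrite inE => Bz.
  by rewrite gee0_abs// lee_fin; exact/ltW/wB.2.
rewrite -[RHS](integral0 (@dV R N) (B : set leb)).
apply: ae_eq_integral => //.
apply: filterS B0 => z B0 Bz; have := wB.2 z Bz.
by have [->] := B0 Bz; rewrite ltxx.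
Qed.

Lemma cmeasurable_subset (A B : set CN) f : measurable (B : set leb) -> A `<=` B ->
  cmeasurable_fun B f -> cmeasurable_fun A f.
Proof.
by move=> mB AB [mRe mIm]; split; [exact: measurable_funS mRe|exact: measurable_funS mIm].
Qed.

Variables (D : set CN) (mu : CN -> R).
Hypotheses (oD : open D) (regD : D = (closure D)°) (wmu : weight (closure D) mu).
Hypothesis bd0 : (\int[dV]_(z in (closure D `\` D° : set leb)) (mu z)%:E = 0)%E.

Lemma measurable_closure : measurable (closure D : set leb).
Proof.
rewrite -(setCK (closure D)); apply: measurableC; apply: open_measurable_leb.
by apply: closed_openC; exact: closed_closure.
Qed.

Let mC := measurable_closure.

Lemma L2sqr_closure f : cmeasurable_fun (closure D) f ->
  L2sqr (closure D) mu f = L2sqr D mu f.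
Proof.
move=> mf; have mD : measurable (D : set leb) by exact: open_measurable_leb.
have mB : measurable (closure D `\` D : set leb) by exact: measurableD.
have B0 : L2sqr (closure D `\` D) mu f = 0%E.
  apply: (energy_null_weight mB).
  - split; last by move=> z [Dz _]; exact: wmu.2.
    by apply: measurable_funS wmu.1 => // z [].
  - by apply: cmeasurable_subset mf => // z [].
  - by move: bd0; rewrite (interior_id _).1.
rewrite /L2sqr -{1}(setDUK (@subset_closure _ D)).
rewrite (ge0_integral_setU _ mD mB)/=; last 3 first.
- rewrite setDUK; last exact: subset_closure.
  by apply/measurable_EFinP; exact: (measurable_density wmu.1 mf).
- move=> z Dz; rewrite lee_fin mulr_ge0 ?sqr_ge0//; apply: (weight_ge0 wmu).
  by case: Dz => [|[]//]; exact: subset_closure.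
- by rewrite disj_set2E setDIK.
by move: B0; rewrite /L2sqr => ->; rewrite adde0.
Qed.

Lemma L2closure_L2H f : L2closure D mu f -> L2H D mu f.
Proof.
move=> [[mf foo] hf]; split; last by rewrite regD.
split; last by rewrite -L2sqr_closure.
exact: cmeasurable_subset (@subset_closure _ D) mf.
Qed.

Lemma Hclosure_L2H : Hclosure D mu `<=` L2H D mu.
Proof. by move=> f [/L2closure_L2H]. Qed.

Lemma Hclosure_lin f g (c : R[i]) : Hclosure D mu f -> Hclosure D mu g ->
  Hclosure D mu (fun z => f z + c * g z).
Proof.
move=> [[Lf hf] [U [F [oU DU hF fF]]]] [[Lg hg] [V [G [oV DV hG gG]]]]; split.
  by split; [exact: L2_lin|exact: holomorphic_lin].
exists (U `&` V), (fun z => F z + c * G z); split.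
- exact: openI.
- by move=> z Dz; split; [exact: DU|exact: DV].
- by apply: holomorphic_lin => z [Uz Vz]; [exact: hF|exact: hG].
- by move=> z Dz; rewrite fF// gG.
Qed.

Lemma Hclosure0 : Hclosure D mu (fun=> 0).
Proof.
split; first by split; [exact: L2_0|exact: holomorphic_cst].
by exists setT, (fun=> 0); split; [exact: openT|by []|exact: holomorphic_cst|by []].
Qed.

Lemma HclosureZ f (c : R[i]) : Hclosure D mu f -> Hclosure D mu (fun z => c * f z).
Proof.
move=> Hf; rewrite (_ : (fun z => _) = fun z => 0 + c * f z).
  exact: Hclosure_lin Hclosure0 Hf.
by apply/funext => z; rewrite add0r.
Qed.

End boundary.

(** * Convergence of the kernels and density *)

Lemma bergman_kernel_regular (R : realType) (N : nat) (U : set (Cvec R N.+1)) nu t :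
  cmeasurable_fun U (fun z => bergman_kernel U nu z t) /\
  holomorphic U (fun z => bergman_kernel U nu z t).
Proof.
rewrite /bergman_kernel; case: (`[< _ >]); last first.
  split; first by split; exact: measurable_cst.
  exact: holomorphic_cst.
have [mm hm] : cmeasurable_fun U (minimal_fun U nu t) /\ holomorphic U (minimal_fun U nu t).
  (* If no minimal function exists, [xget] returns the zero function, which is just as regular. *)
  rewrite /minimal_fun; case: xgetP => [m -> [[[[? _] ?] _] _]//|_].
  split; first by split; exact: measurable_cst.
  exact: holomorphic_cst.
set c := (real_complex _ _)^-1.
rewrite (_ : (fun z => _) = fun z => 0 + c * minimal_fun U nu t z); last first.
  by apply/funext => z; rewrite add0r mulrC.
split; last by apply: holomorphic_lin => //; exact: holomorphic_cst.
by apply: complex_measurable_lin => //; split; exact: measurable_cst.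
Qed.

Local Notation normc := ComplexField.Normc.normc.

(** Used at the diagonal points (t, t), where it gives k_n(t) -> K(t, t). *)
Lemma cvg_locally_uniformly_on_pointwise (R : realType) (T : topologicalType)
    (A : set T) (Fn : nat -> T -> R[i]) (F : T -> R[i]) p :
  cvg_locally_uniformly_on A Fn F -> A p ->
  forall e : R, 0 < e -> exists M, forall n, (M <= n)%N ->
    normc (F p - Fn n p) < e.
Proof.
move=> cvgF Ap e e0; have [V pV] := cvgF p Ap.
move=> /(_ [set h | forall y, (V `&` A) y -> `|F y - h y| < e%:C%C]).
case.
  apply/uniform_nbhs; exists [set xy | ball xy.1 e%:C%C xy.2]; split.
    by rewrite -entourage_ballE; exists e%:C%C => //=; rewrite ltcR.
  by move=> h /= H y Vy; have := H y Vy.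
move=> M _ HM; exists M => n Mn.
have := HM n Mn p (conj (nbhs_singleton pV) Ap).
by rewrite /= norm_normc ltcR.
Qed.

Theorem theorem15 (R : realType) (N : nat)
  (D : set (Cvec R N.+1)) (mu : Cvec R N.+1 -> R)
  (Dn : nat -> set (Cvec R N.+1)) (mun : nat -> Cvec R N.+1 -> R)
  (domD : is_domain D) (regD : D = (closure D)°)
  (wmu : weight (closure D) mu)
  (bd0 : (\int[dV]_(z in (closure D `\` D° : set (lebCvec R N))) (mu z)%:E = 0)%E)
  (AWmu : AW D mu)
  (domDn : forall n, is_domain (Dn n))
  (approxD : approximates_from_outside D Dn)
  (AWmun : forall n, AW (Dn n) (mun n))
  (cvgK : cvg_locally_uniformly_on (D `*` D)
     (fun n p => bergman_kernel (Dn n) (mun n) p.1 p.2)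
     (fun p => bergman_kernel D mu p.1 p.2))
  (L2K : forall t, D t -> forall n,
     L2H D mu (fun z => bergman_kernel (Dn n) (mun n) z t))
  (cvgL2K : forall t, D t ->
     (fun n => L2norm D mu (fun z => bergman_kernel (Dn n) (mun n) z t) ^+ 2)
       @ \oo --> L2norm D mu (fun z => bergman_kernel D mu z t) ^+ 2)
  (L2Ktt : forall t, D t ->
     real_complex R (L2norm D mu (fun z => bergman_kernel D mu z t) ^+ 2) =
       bergman_kernel D mu t t) :
  forall f, L2closure D mu f -> forall e : R, 0 < e ->
    exists2 h, Hclosure D mu h & L2norm (closure D) mu (f \- h) < e.
Proof.
have [_ oD _] := domD.
have wD := AW_weight AWmu.
have mD : measurable (D : set (lebCvec R N)) by exact: open_measurable_leb.
pose q := sqnorm (@dV R N) D mu.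
pose K t z := bergman_kernel D mu z t.
pose k t n z := bergman_kernel (Dn n) (mun n) z t.
have LK t : D t -> L2H D mu (K t).
  by move=> Dt; case: (bergman_kernel_reproducing oD AWmu Dt).
have rep t (Dt : D t) g c : L2H D mu g -> q (fun z => g z + c * K t z) = q g +
    2 * (complex.Re c * complex.Re (g t) + complex.Im c * complex.Im (g t)) +
    normc c ^+ 2 * q (K t).
  by move=> Lg; have [_ /(_ g c Lg)] := bergman_kernel_reproducing oD AWmu Dt.
have L2q g : L2norm D mu g ^+ 2 = q g.
  by rewrite L2normE sqr_sqrtr//; exact: (wsqnorm_ge0 wD).
(* Expanding with c = -1 gives q(k_n) - 2 Re k_n(t) + q(K). Errors of e/4 in q(k_n) and in Re k_n(t)
   add up to at most 3e/4. *)
have k_cvg t (e : R) : D t -> 0 < e ->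
    exists M, forall n, (M <= n)%N -> q (fun z => k t n z + (-1) * K t z) <= e.
  move=> Dt e0; have e4 : 0 < e / 4 by lra.
  have [M1 HM1] := cvg_locally_uniformly_on_pointwise cvgK (conj Dt Dt : (D `*` D) (t, t)) e4.
  have [M2 _ HM2] : \forall n \near \oo, `|q (K t) - q (k t n)| < e / 4.
    have := cvgL2K t Dt => /cvgrPdist_lt/(_ _ e4).
    move=> [M _ HM]; exists M => // n Mn.
    rewrite -(L2q (K t)) -(L2q (k t n)); exact: HM n Mn.
  exists (maxn M1 M2) => n; rewrite geq_max => /andP[Mn1 Mn2].
  rewrite (rep t Dt _ (-1) (L2K t Dt n)) normc_sqr.
  have Ktt : K t t = (q (K t))%:C%C by rewrite -(L2q (K t)); exact: (esym (L2Ktt t Dt)).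
  have : normc (K t t - k t n t) < e / 4 := HM1 n Mn1.
  move/(le_lt_trans (normc_ge_absRe _)); rewrite Ktt raddfB /= ltr_norml.
  have := HM2 n Mn2; rewrite ltr_norml /=.
  rewrite oppr0 mul0r addr0 expr0n sqrrN expr1n addr0 mul1r mulN1r.
  move: (q (K t)) (q (k t n)) (complex.Re (k t n t)) => x y w; lra.
(* With the whole space as [G], the closure of D lies in D_n for large [n]; the kernel, being
   holomorphic on D_n, is then its own extension. *)
have k_H t : D t -> exists M, forall n, (M <= n)%N -> Hclosure D mu (k t n).
  move=> Dt; have [_ /(_ setT openT (@subsetT _ _))[M _ HM]] := approxD.
  exists M => n /HM[DDn _ _].
  have [mk hk] := @bergman_kernel_regular R N (Dn n) (mun n) t.
  have [_ oDn _] := domDn n.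
  have [Lk hkD] := L2K t Dt n.
  have mkD : cmeasurable_fun (closure D) (k t n).
    by apply: (cmeasurable_subset _ DDn mk); exact: open_measurable_leb.
  split; last by exists (Dn n), (k t n); split.
  split; last by rewrite -regD.
  by split => //; rewrite L2sqr_closure//; case: Lk.
move=> f Lf e e0.
have LHf := L2closure_L2H oD regD wmu bd0 Lf.
have [|||| s [h [Hs Lh hs hmin]]] :=
    @L2H_projection _ _ D mu oD AWmu (Hclosure D mu) f.
- by exists (fun=> 0); exact: Hclosure0.
- exact: Hclosure_L2H.
- move=> g1 g2 H1 H2.
  rewrite (_ : (fun z => _) = fun z => 2^-1 * (g1 z + 1 * g2 z)).
    exact: (HclosureZ wmu _ (Hclosure_lin wmu _ H1 H2)).
  by apply/funext => z; rewrite mul1r.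
- exact: LHf.
have Ls n : L2H D mu (s n) := Hclosure_L2H oD regD wmu bd0 (Hs n).
have fh : {in D, f =1 h}.
  move=> t; rewrite inE => Dt.
  have Lu : L2H D mu (f \- h) := L2HB oD AWmu LHf Lh.
  (* Neither [h] nor [K t] need be in H(closure D, mu), so minimality is applied to s n - c k_m. The
     discrepancy w = (h - s n) + c (k_m - K) is small, and [le_of_split] removes it. *)
  have var c : q (f \- h) <= q (fun z => (f \- h) z + c * K t z).
    apply: le_of_split => [|r d r0 d0]; first exact: (wsqnorm_ge0 wD).
    (* Since q(w) <= 2 q(h - s n) + 2|c|^2 q(k_m - K), the tolerances d/4 and (d/4)/(|c|^2 + 1) give
       q(w) <= d; the added 1 covers c = 0. *)
    have c1 : 0 < normc c ^+ 2 + 1 by rewrite ltr_wpDl ?sqr_ge0.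
    have d4 : 0 < d / 4 by lra.
    have [n /(_ n (leqnn n)) Hn] := hs _ d4.
    have [M2 HM2] := k_cvg t _ Dt (divr_gt0 d4 c1).
    have [M3 HM3] := k_H t Dt.
    pose m := maxn M2 M3.
    pose w z := (h \- s n) z + c * (k t m z + (-1) * K t z).
    have Lkm : L2H D mu (fun z => k t m z + (-1) * K t z) :=
      L2H_lin oD AWmu (-1) (L2K t Dt m) (LK t Dt).
    have Lhs : L2H D mu (h \- s n) := L2HB oD AWmu Lh (Ls n).
    have Lw : L2H D mu w := L2H_lin oD AWmu c Lhs Lkm.
    have Luc : L2H D mu (fun z => (f \- h) z + c * K t z) :=
      L2H_lin oD AWmu c Lu (LK t Dt).
    have Hg : Hclosure D mu (fun z => s n z + (- c) * k t m z).
      exact: (Hclosure_lin wmu (- c) (Hs n) (HM3 m (leq_maxr _ _))).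
    apply: le_trans (hmin _ Hg) _.
    rewrite (@eq_sqnorm _ _ _ _ _ ((fun z => (f \- h) z + c * K t z) \+ w)); last first.
      by move=> z _; rewrite /w /=; ring.
    apply: le_trans (wsqnormD_le mD wD r0 Luc.1 Lw.1) _.
    have ri : 0 < r^-1 by rewrite invr_gt0.
    have r1 : 0 < 1 + r^-1 by lra.
    have r2 : 0 < 1 + r by lra.
    apply: lerD; first by rewrite ler_pM2l// lerDl ltW.
    rewrite ler_pM2l//.
    have Lckm := L2HZ oD AWmu c Lkm.
    apply: le_trans (wsqnormD_le mD wD ltr01 Lhs.1 Lckm.1) _.
    rewrite (wsqnormZ mD wD _ Lkm.1) invr1.
    have H2 := HM2 m (leq_maxl _ _).
    have : normc c ^+ 2 * q (fun z => k t m z + (-1) * K t z) <= d / 4.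
      apply: le_trans (ler_wpM2l (sqr_ge0 _) H2) _.
      rewrite mulrCA ler_piMr ?(ltW d4)// ler_pdivrMr// mul1r; lra.
    rewrite -/q; move: Hn; rewrite -/q.
    by move: (q _) (normc c ^+ 2 * _) => x y; lra.
  (* For u = f - h and c = r u(t) with [r] real, [var] reads 0 <= 2r|u(t)|^2 + r^2 |u(t)|^2 q(K), so
     the linear coefficient vanishes. *)
  have /eqP : normc ((f \- h) t) ^+ 2 = 0.
    have : 2 * normc ((f \- h) t) ^+ 2 = 0.
      apply: (@quadratic_ge0_linear0 _ _ (normc ((f \- h) t) ^+ 2 * q (K t))).
        by apply: mulr_ge0; [exact: sqr_ge0|exact: (wsqnorm_ge0 wD)].
      move=> r; have := var (r%:C%C * (f \- h) t).
      rewrite (rep t Dt _ _ Lu) -subr_ge0 => H; apply: le_trans H _.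
      by rewrite !normc_sqr !ReM !ImM /=; rewrite le_eqVlt; apply/orP; left; apply/eqP; ring.
    by move/eqP; rewrite mulf_eq0 pnatr_eq0 => /eqP.
  rewrite sqrf_eq0 => /eqP/ComplexField.Normc.eq0_normc/eqP.
  by rewrite subr_eq0 => /eqP.
(* Halving e^2 makes the final inequality strict. As f = h on D and the boundary carries no mass, f
   - s M over the closure has the squared norm of h - s M over D. *)
have [M /(_ M (leqnn M)) HM] := hs (e ^+ 2 / 2) ltac:(by rewrite divr_gt0// exprn_gt0).
exists (s M) => //.
have [mfs _] : L2 (closure D) mu (f \- s M).
  exact: (L2B (measurable_closure D) wmu Lf.1 (Hs M).1.1).
rewrite L2norm_lt//.
have -> : sqnorm (@dV R N) (closure D) mu (f \- s M) = q (f \- s M).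
  exact: (congr1 fine (L2sqr_closure oD wmu bd0 mfs)).
apply: le_lt_trans (_ : e ^+ 2 / 2 < _); last first.
  by have := exprn_gt0 2 e0; lra.
apply: le_trans HM; rewrite le_eqVlt; apply/orP; left; apply/eqP.
by apply: eq_sqnorm => z /fh /= ->.
Qed.
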